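(* For all integers $n,s\geq 1$ the following identities hold in $\mathbb{Q}[t]$: \begin{align*} (t-4)\sum_{k=1}^n \frac{t^{k-1}}{\binom{2k}{k}}+ 2\sum_{k=1}^n \frac{t^{k-1}}{k\binom{2k}{k}} &= \frac{t^n}{\binom{2n}{n}}-1,\\ (t-4)\sum_{k=1}^n \frac{t^{k-1}H_{k-1}(s)}{\binom{2k}{k}}+ 2\sum_{k=1}^n \frac{t^{k-1}H_{k-1}(s)}{k\binom{2k}{k}} &= \frac{t^nH_n(s)}{\binom{2n}{n}}-\sum_{k=1}^n \frac{t^{k}}{k^s\binom{2k}{k}}. \end{align*}
   Context: For integers $k\ge 0$ and $s\ge 1$, $H_k(s)=\sum_{r=1}^k 1/r^s$ (so $H_0(s)=0$). *)

(* Defs.v *)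
From mathcomp Require Import all_boot all_order all_algebra.
Set Implicit Arguments.
Unset Strict Implicit.
Unset Printing Implicit Defensive.
Import GRing.Theory.
Local Open Scope ring_scope.

Definition harmonic (k s : nat) : rat :=
  \sum_(1 <= r < k.+1) 1 / r%:R ^+ s.

(* Main.v *)
Require Import Defs.
From mathcomp Require Import all_boot all_order all_algebra.
From mathcomp Require Import ring zify.
Set Implicit Arguments.
Unset Strict Implicit.
Unset Printing Implicit Defensive.
Import GRing.Theory.
Local Open Scope ring_scope.

(* With b k = 1 / 'C(2 * k, k), the recurrence (4 - 2 / k) * b k = b k.-1 turns
   (t - 4) * b k * t ^ (k - 1) + 2 / k * b k * t ^ (k - 1) into the difference
   b k * t ^ k - b k.-1 * t ^ (k - 1); both identities are then summation by
   parts against a weight w, with w = 1 and w = harmonic ^~ s respectively. *)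

(** Absorption is applied twice, to rows [2k+2] and [2k+1]; the symmetry
    ['C(2k+1, k) = 'C(2k+1, k+1)] links the two. *)
Lemma mul_central_binS (k : nat) :
  (k.+1 * 'C(2 * k.+1, k.+1) = (4 * k + 2) * 'C(2 * k, k))%N.
Proof.
have h1 := mul_bin_diag (2 * k.+1) k.
have h2 := mul_bin_diag (2 * k).+1 k.
have e1 : ((2 * k.+1).-1 = (2 * k).+1)%N by lia.
have e2 : ('C((2 * k).+1, k) = 'C((2 * k).+1, k.+1))%N.
  by rewrite -(@bin_sub _ k.+1) ?subSS; [congr 'C(_, _); lia | lia].
by rewrite -h1 e1 e2 -mulnA -h2 /=; lia.
Qed.

Lemma central_bin_neq0 (k : nat) : 'C(2 * k, k)%:R != 0 :> rat.
Proof. by rewrite Num.Theory.pnatr_eq0 -lt0n bin_gt0; lia. Qed.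

Lemma inv_central_binS (k : nat) :
  (4 - 2 / k.+1%:R) / 'C(2 * k.+1, k.+1)%:R = 'C(2 * k, k)%:R^-1 :> rat.
Proof.
have k0 : k%:R + 1 != 0 :> rat by rewrite natr1 Num.Theory.pnatr_eq0.
have b0 := central_bin_neq0 k.
have b1 := central_bin_neq0 k.+1.
have := congr1 (fun m => m%:R : rat) (mul_central_binS k).
rewrite !natrM natrD natrM -natr1; move: k0 b0 b1.
move: (k%:R) ('C(2 * k, k)%:R) ('C(2 * k.+1, k.+1)%:R) => x y z x0 y0 z0 e.
(* Clearing the denominators [y], [z] and [x + 1] leaves the integer recurrence [e]. *)
apply: (mulIf y0); apply: (mulIf z0); apply: (mulIf x0).
have -> : (4 - 2 / (x + 1)) / z * y * z * (x + 1) = (4 * x + 2) * y.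
  by field; rewrite x0 z0.
by rewrite mulVf // mul1r [RHS]mulrC e.
Qed.

Lemma central_bin_sum_by_parts (w : nat -> rat) (n : nat) :
  ('X - 4%:P) * (\sum_(1 <= k < n.+1) (w (k - 1)%N / 'C(2 * k, k)%:R) *: 'X^(k - 1))
    + 2%:P * (\sum_(1 <= k < n.+1)
                (w (k - 1)%N / (k%:R * 'C(2 * k, k)%:R)) *: 'X^(k - 1))
  = (w n / 'C(2 * n, n)%:R) *: 'X^n - (w 0)%:P
    - \sum_(1 <= k < n.+1)
        ((w k - w (k - 1)%N) / 'C(2 * k, k)%:R) *: 'X^k :> {poly rat}.
Proof.
elim: n => [|n IH].
  by rewrite !big_nil muln0 bin0 divr1 expr0 alg_polyC !mulr0 addr0 !subrr.
rewrite !(big_nat_recr n.+1) //= subn1 /= !mulrDr addrACA IH.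
(* Once [b n] is rewritten through [b n.+1], only the terms at [n.+1] remain to be matched, a
   polynomial identity in ['X], ['X^n], the weights, [b n.+1] and the inverse of [n.+1]. *)
rewrite -!mul_polyC -(inv_central_binS n) invfM exprS.
rewrite !(polyCM, polyCB); ring.
Qed.

Lemma harmonicS (k s : nat) :
  harmonic k.+1 s = harmonic k s + 1 / k.+1%:R ^+ s.
Proof. by rewrite /harmonic big_nat_recr. Qed.

Theorem theorem5p3 (n s : nat) (hn : (1 <= n)%N) (hs : (1 <= s)%N) :
  ('X - 4%:P) * (\sum_(1 <= k < n.+1) (1 / 'C(2 * k, k)%:R) *: 'X^(k - 1))
    + 2%:P * (\sum_(1 <= k < n.+1)
                (1 / (k%:R * 'C(2 * k, k)%:R)) *: 'X^(k - 1))
  = (1 / 'C(2 * n, n)%:R) *: 'X^n - 1 :> {poly rat}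
  /\
  ('X - 4%:P) * (\sum_(1 <= k < n.+1)
                   (harmonic (k - 1) s / 'C(2 * k, k)%:R) *: 'X^(k - 1))
    + 2%:P * (\sum_(1 <= k < n.+1)
                (harmonic (k - 1) s / (k%:R * 'C(2 * k, k)%:R)) *: 'X^(k - 1))
  = (harmonic n s / 'C(2 * n, n)%:R) *: 'X^n
    - \sum_(1 <= k < n.+1)
        (1 / (k%:R ^+ s * 'C(2 * k, k)%:R)) *: 'X^k :> {poly rat}.
Proof.
split.
  (* A constant weight has zero increments, so the correction sum vanishes. *)
  rewrite (central_bin_sum_by_parts (fun=> 1)) big1 ?subr0 // => k _.
  by rewrite subrr mul0r scale0r.
rewrite (central_bin_sum_by_parts (harmonic ^~ s)).
(* The boundary term is an empty sum; what remains is that the weight grows by [1 / k ^ s] at step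
   [k]. *)
rewrite [harmonic 0 s]big_nil polyC0 subr0; congr (_ - _).
apply: eq_big_nat => -[//|k] _.
by rewrite subn1 harmonicS addrC addKr !div1r invfM.
Qed.
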